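(* Let $n$ and $k$ be positive integers, and let $c:E(K_{2kn})\to [k]$ be an edge-coloring (not necessarily proper) of the complete graph $K_{2kn}$ on $2kn$ vertices such that, for every $i\in[k]$, there are equally many edges $e$ with $c(e)=i$. Then there is a perfect matching $M$ of $K_{2kn}$ with $$f(M)=\sum_{i=1}^k\Big||c^{-1}(i)\cap M|-n\Big|\leq 3k\sqrt{kn\ln(2k)}.$$
   Context: $[k]=\{1,\ldots,k\}$. For a perfect matching $M$ of $K_{2kn}$, $|c^{-1}(i)\cap M|$ is the number of edges of $M$ with color $i$. *)

(* Defs.v *)
From mathcomp Require Import all_boot.

Set Implicit Arguments.
Unset Strict Implicit.
Unset Printing Implicit Defensive.

Definition complete_edges (V : finType) : {set {set V}} :=
  [set e : {set V} | #|e| == 2].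

Definition perfect_matching (V : finType) (M : {set {set V}}) : bool :=
  [&& M \subset complete_edges V, trivIset M & cover M == [set: V]].

(* A colouring is given as a function on all sets of vertices, but only its    *)
(* values on edges are ever used: the colour class c^-1(i) consists of edges.  *)
Definition color_class (V : finType) (k : nat) (c : {set V} -> 'I_k)
    (i : 'I_k) : {set {set V}} :=
  [set e in complete_edges V | c e == i].

(* Main.v *)
(* Second moment method. Transport a fixed pairing of the N = 2kn vertices by a
   uniformly random permutation, and let X_i be the number of edges of colour i
   in the resulting perfect matching. Two given edges of the matching form a
   uniformly random pair of disjoint edges, and all colour classes have the same
   size, so they are both of colour i with probability at most
   N(N - 1) / (k^2 (N - 2)(N - 3)). Hence sum_i X_i^2 has expectation at most
   k n^2 + 3 k n (trivially so when k = 1), and some matching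
   satisfies sum_i (X_i - n)^2 <= 3 k n. Then sum_i |X_i - n| <= k sqrt(3n), which is
   stronger than the required bound. *)
Require Import Defs.
From mathcomp Require Import all_boot all_order all_algebra.
From mathcomp Require Import reals exp.
From mathcomp Require Import all_fingroup zify ring lra.
Import Order.TTheory GRing.Theory Num.Theory.
Local Open Scope ring_scope.

Lemma sum_nat_of_bool (T : finType) (P : pred T) :
  (\sum_x P x = #|[set x | P x]|)%N.
Proof.
rewrite -sum1_card [RHS]big_mkcond; apply: eq_bigr => x _.
by rewrite inE; case: (P x).
Qed.

Lemma card_perm_type (T : finType) : #|{perm T}| = #|T|`!%N.
Proof.
rewrite -cardsT -card_perm; apply: eq_card => s; rewrite inE; symmetry.
by apply/subsetP => x; rewrite inE.
Qed.

(** * Counting permutations with prescribed values *)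

Section RandomMatching.
Local Open Scope nat_scope.
Variable V : finType.

(** Right multiplication by the inverse of [s0] injects these permutations into those that fix [S]
    pointwise. *)
Lemma card_perm_agree (S : {set V}) (s0 : {perm V}) :
  #|[set s : {perm V} | [forall x in S, s x == s0 x]]| <= (#|V| - #|S|)`!.
Proof.
have -> : #|V| - #|S| = #|~: S| by rewrite [RHS]cardsCs setCK.
rewrite -card_perm -(card_imset _ (mulIg s0^-1%g)).
apply/subset_leq_card/subsetP => _ /imsetP [s + ->]; rewrite inE => /forall_inP sS.
apply/subsetP => x; rewrite !inE permM; apply: contra => /sS /eqP ->.
by rewrite permK.
Qed.

(** Members of one fibre of [g] agree on [S], so [card_perm_agree] bounds each of the at most [#|Q|]
    fibres. *)
Lemma card_perm_preimset (W : finType) (S : {set V}) (g : {perm V} -> W)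
    (Q : {set W}) :
  (forall s t : {perm V}, g s = g t -> {in S, s =1 t}) ->
  #|g @^-1: Q| <= #|Q| * (#|V| - #|S|)`!.
Proof.
move=> gS; rewrite -sum1_card (partition_big g (mem Q)) /=; last first.
  by move=> s; rewrite inE.
rewrite -sum_nat_const; apply: leq_sum => w _; rewrite sum1_card.
have [s0 /andP [_ /eqP gs0]|none] := pickP [pred s | (s \in g @^-1: Q) && (g s == w)];
  last by rewrite eq_card0.
apply: leq_trans (card_perm_agree S s0).
apply/subset_leq_card/subsetP => s; rewrite !inE => /andP [_ /eqP gs].
by apply/forall_inP => x xS; apply/eqP/gS; rewrite // gs gs0.
Qed.

(** Edges are counted with orientation because the ordered image of a pair determines the
    permutation at both points, whereas the unordered image does not. *)
Definition arcs (E : {set {set V}}) : {set V * V} :=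
  [set q | [set q.1; q.2] \in E].

Lemma set2_inj_swap (a b x y : V) :
  [set a; b] = [set x; y] -> (a, b) = (x, y) \/ (a, b) = (y, x).
Proof.
move/setP => E; move: (E a) (E b) (E x) (E y); rewrite !inE !eqxx !orbT /=.
move=> /esym /orP [] /eqP -> /esym /orP [] /eqP ->; rewrite ?orbb.
- by move=> _ /eqP ->; left.
- by left.
- by right.
- by move=> /eqP ->; left.
Qed.

Lemma card_arcs (E : {set {set V}}) :
  E \subset complete_edges V -> #|arcs E| = #|E| * 2.
Proof.
move=> /subsetP sE.
rewrite -sum1_card (partition_big (fun q => [set q.1; q.2]) (mem E)) /=; last first.
  by move=> q; rewrite inE.
rewrite -sum_nat_const; apply: eq_bigr => e eE; rewrite sum1_card.
have := sE e eE; rewrite inE => /cards2P [x [y [xy De]]].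
have -> : 2 = #|[set (x, y); (y, x)]|.
  by rewrite cards2 xpair_eqE negb_and xy.
apply: eq_card => -[a b]; rewrite !inE /= unfold_in /=.
apply/andP/orP => [[_ /eqP] | [] /eqP [-> ->]].
- by rewrite De => /set2_inj_swap [] ->; [left | right].
- by rewrite inE /= -De eE.
- by rewrite inE /= setUC -De eE.
Qed.

(** * The fixed pairing and its images under permutations *)

Variables (h : nat) (p : 'I_h * bool -> V).
Hypothesis p_bij : bijective p.

Definition pair_image (s : {perm V}) (j : 'I_h) : V * V :=
  (s (p (j, false)), s (p (j, true))).

Definition matching_image (s : {perm V}) : {set {set V}} :=
  [set [set (pair_image s j).1; (pair_image s j).2] | j in 'I_h].

Lemma card_verts : #|V| = h * 2.
Proof. by rewrite -(bij_eq_card p_bij) card_prod card_ord card_bool. Qed.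

Lemma sp_eq (s : {perm V}) x y : (s (p x) == s (p y)) = (x == y).
Proof. by rewrite (inj_eq perm_inj) (inj_eq (bij_inj p_bij)). Qed.

(** Distinct indices give disjoint nonempty pairs, hence distinct ones. Injectivity lets the edges
    of the matching be counted by index. *)
Lemma matching_image_props s :
  trivIset (matching_image s) /\
  injective (fun j => [set (pair_image s j).1; (pair_image s j).2]).
Proof.
have [||tI eI] := @trivIimset V 'I_h (mem 'I_h)
  (fun j => [set (pair_image s j).1; (pair_image s j).2]).
- move=> i j _ _ ji; rewrite disjoints_subset; apply/subsetP => x.
  by rewrite !inE => /orP [] /eqP -> /=; rewrite !sp_eq !xpair_eqE eq_sym (negPf ji).
- by apply/imsetP => -[j _ /setP /(_ (pair_image s j).1)]; rewrite !inE eqxx.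
by split=> // i j; apply: eI.
Qed.

Lemma perfect_matching_image s : perfect_matching (matching_image s).
Proof.
have [tI _] := matching_image_props s.
apply/and3P; split => //.
  apply/subsetP => _ /imsetP [j _ ->].
  by rewrite inE cards2 /= sp_eq xpair_eqE andbF.
apply/eqP/setP => x; rewrite inE; apply/bigcupP.
have [q _ pK] := p_bij.
have := pK (s^-1%g x); case: (q _) => j b pE.
exists [set (pair_image s j).1; (pair_image s j).2]; first exact: imset_f.
have xE : s (p (j, b)) = x by rewrite pE permKV.
by rewrite -xE !inE !sp_eq !xpair_eqE eqxx; case: b {pE xE}.
Qed.

Lemma card_matching_image (E : {set {set V}}) s :
  #|E :&: matching_image s| = \sum_j (pair_image s j \in arcs E).
Proof.
have [_ eI] := matching_image_props s.
rewrite sum_nat_of_bool -(card_imset _ eI).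
apply: eq_card => e; rewrite inE.
apply/andP/imsetP => [[eE /imsetP [j _ De]]|[j jE De]].
by exists j; rewrite // !inE -De.
by move: jE; rewrite !inE -De => ->; split => //; rewrite De; apply: imset_f.
Qed.

(** The two pairs occupy four vertices, and their images determine the permutation there. Choices of
    two arcs that share a vertex are included in the bound. *)
Lemma card_two_pairs (D : {set V * V}) (i j : 'I_h) : i != j ->
  #|[set s | (pair_image s i \in D) && (pair_image s j \in D)]|
    <= #|D| ^ 2 * (h * 2 - 4)`!.
Proof.
move=> ij; pose S := p @: setX [set i; j] [set: bool].
have cS : #|S| = 4.
  by rewrite card_imset ?cardsX ?cards2 ?ij ?cardsT ?card_bool //; apply: bij_inj.
rewrite -card_verts -cS expnS expn1 -cardsX.
apply: leq_trans (@card_perm_preimset _ S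
  (fun s => (pair_image s i, pair_image s j)) _ _).
  by apply: subset_leq_card; apply/subsetP => s; rewrite !inE.
move=> s t [E1 E2 E3 E4] _ /imsetP [[x b] + ->].
by rewrite !inE andbT /= => /orP [] /eqP ->; case: b.
Qed.

(** Expand the square over pairs of indices. The diagonal gives [h] per permutation, as each
    matching edge has exactly one colour; each off-diagonal pair is handled by [card_two_pairs],
    colour by colour. *)
Lemma sum_sqr_count (k d : nat) (D : 'I_k -> {set V * V}) :
    (forall q, q.1 != q.2 -> \sum_i (q \in D i) = 1) ->
    (forall i, #|D i| = d) ->
  \sum_(s : {perm V}) \sum_i (\sum_j (pair_image s j \in D i)) ^ 2
    <= (h * 2)`! * h + h * h.-1 * (k * (d ^ 2 * (h * 2 - 4)`!)).
Proof.
move=> D1 Dd.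
have sq s i : (\sum_j (pair_image s j \in D i)) ^ 2 =
    \sum_j (pair_image s j \in D i) +
    \sum_j \sum_(j' | j' != j) ((pair_image s j \in D i) && (pair_image s j' \in D i)).
  rewrite expnS expn1 big_distrlr /= -big_split /=; apply: eq_bigr => j _.
  rewrite (bigD1 j) //=; congr (_ + _); first by case: (_ \in _).
  by apply: eq_bigr => j' _; rewrite mulnb.
under eq_bigr do (under eq_bigr do rewrite sq); under eq_bigr do rewrite big_split /=.
rewrite big_split /=; apply: leq_add.
  under eq_bigr do rewrite exchange_big /=.
  under eq_bigr => s _ do under eq_bigr => j _ do
    rewrite D1 /= ?sp_eq ?xpair_eqE ?andbF //.
  rewrite !sum_nat_const !card_ord muln1 leq_mul2r; apply/orP; right.
  by rewrite -card_verts -card_perm_type.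
under eq_bigr do rewrite exchange_big /=.
rewrite exchange_big /=.
under eq_bigr do under eq_bigr do rewrite exchange_big /=.
under eq_bigr do rewrite exchange_big /=.
apply: leq_trans (_ : \sum_(j < h) \sum_(j' | j' != j)
   (k * (d ^ 2 * (h * 2 - 4)`!)) <= _).
  apply: leq_sum => j _; apply: leq_sum => j' jj'.
  rewrite exchange_big /= -[X in X * _]card_ord -sum_nat_const.
  apply: leq_sum => i _; rewrite -(Dd i) sum_nat_of_bool.
  by apply: card_two_pairs; rewrite eq_sym.
rewrite -mulnA -[X in _ <= X * _]card_ord -sum_nat_const leq_sum // => j _.
rewrite sum_nat_cond_const leq_mul2r; apply/orP; right.
have -> : h.-1 = #|[set~ j]| by rewrite cardsC1 card_ord.
by apply/subset_leq_card/subsetP => j'; rewrite !inE.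
Qed.

End RandomMatching.

(** * Averaging and the numerical bound *)

Lemma exists_le_average (T : finType) (x0 : T) (F : T -> nat) (B : nat) :
  (\sum_x F x <= B)%N -> exists x, (#|T| * F x <= B)%N.
Proof.
move=> FB; have [x _ xmin] := arg_minnP F (erefl : xpredT x0).
exists x; apply: leq_trans FB; rewrite -sum_nat_const.
by apply: leq_sum => y _; apply: xmin.
Qed.

(** Write N = 2kn. Since kd = N(N - 1) and kn - 1 = (N - 2)/2, the last term divided by N! is kn^2
    (N - 1)/(N - 3) = kn^2 + 2kn^2/(N - 3). As n <= N - 3 for k > 1, this is at most kn^2 + 2kn. *)
Lemma second_moment_arith (n k d Y : nat) :
    (0 < n)%N -> (1 < k)%N ->
    (k * d = (2 * k * n) * (2 * k * n).-1)%N ->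
    ((k * n * 2)`! * Y <= (k * n * 2)`! * (k * n)
       + k * n * (k * n).-1 * (k * (d ^ 2 * (k * n * 2 - 4)`!)))%N ->
  (Y <= k * n ^ 2 + 3 * (k * n))%N.
Proof.
move=> n0 k1 kd.
have [m knE] : exists m, (k * n = m.+2)%N by exists (k * n - 2)%N; nia.
have NE : (2 * k * n = m.*2.+4)%N by lia.
have -> : (k * n * 2 = m.*2.+4)%N by lia.
have nm : (n <= m.*2.+1)%N by nia.
rewrite NE /= in kd; rewrite knE subSS subSS subSS subSS subn0 /=.
rewrite !factS; set f := _`!.
have f0 : (0 < f)%N by apply: fact_gt0.
move: f f0 => f f0 H.
have {}H : (m.*2.+4 * m.*2.+3 * m.*2.+2 * m.*2.+1 * Y <=
  m.*2.+4 * m.*2.+3 * m.*2.+2 * m.*2.+1 * m.+2 + m.+2 * m.+1 * (k * d ^ 2))%N.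
  rewrite -(leq_pmul2l f0); apply: leq_trans (leq_trans H _); apply: eq_leq; ring.
have {}H : (m.*2.+1 * Y <= m.*2.+1 * (k * n) + n * (k * n) * m.*2.+3)%N.
  (* The factor to cancel is kN(N - 1)(N - 2), where N = 2m + 4. *)
  have c0 : (0 < m.*2.+4 * m.*2.+3 * m.+1 * 2 * k)%N by rewrite !muln_gt0; lia.
  rewrite -(leq_pmul2l c0) knE.
  have N2E : (m.*2.+2 = 2 * m.+1)%N by lia.
  have sq : (k * (m.+2 * m.+1 * (k * d ^ 2)) = m.+2 * m.+1 * (k * d) ^ 2)%N by ring.
  move: H; rewrite -(leq_pmul2l (ltnW k1)) mulnDr sq kd N2E => H.
  apply: leq_trans (leq_trans H _); apply: eq_leq; first by ring.
  have -> : ((2 * m.+1).+2 = 2 * k * n)%N by lia.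
  ring.
rewrite -knE -(leq_pmul2l (isT : 0 < m.*2.+1)%N); apply: leq_trans H _.
have := leq_mul (leqnn (2 * (k * n))) nm; lia.
Qed.

Theorem theorem2 (R : realType) (n k : nat) (hn : (0 < n)%N) (hk : (0 < k)%N)
    (c : {set 'I_(2 * k * n)} -> 'I_k)
    (hc : forall i j : 'I_k, #|color_class c i| = #|color_class c j|) :
  exists2 M : {set {set 'I_(2 * k * n)}},
    perfect_matching M &
    \sum_(i < k) `| #|color_class c i :&: M|%:R - n%:R |
      <= 3 * k%:R * Num.sqrt (k%:R * n%:R * ln (2 * k%:R)) :> R.
Proof.
set V := 'I_(2 * k * n) in c hc *.
have cardW : #|{: 'I_(k * n) * bool}| = #|V|.
  by rewrite card_prod !card_ord card_bool; lia.
pose p (w : 'I_(k * n) * bool) : V := enum_val (cast_ord cardW (enum_rank w)).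
have p_bij : bijective p.
  exists (fun v => enum_val (cast_ord (esym cardW) (enum_rank v))) => x.
    by rewrite /p enum_valK cast_ordK enum_rankK.
  by rewrite /p enum_valK cast_ordKV enum_rankK.
pose M s := matching_image V (k * n) p s.
pose X i s := #|color_class c i :&: M s|.
pose D i := arcs V (color_class c i).
pose d := #|D (Ordinal hk)|.
have Dd i : #|D i| = d.
  have sub j : color_class c j \subset complete_edges V.
    by apply/subsetP => e; rewrite !inE => /andP [].
  rewrite /d /D !card_arcs ?sub //; congr (_ * _)%N; exact: hc.
have D1 q : q.1 != q.2 -> (\sum_i (q \in D i) = 1)%N.
  move=> q12; rewrite (bigD1 (c [set q.1; q.2])) //= big1 => [|i ci].
    by rewrite !inE cards2 q12 !eqxx.
  by rewrite /D !inE [_ == i]eq_sym (negPf ci) andbF.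
have sumX s : (\sum_i X i s = k * n)%N.
  under eq_bigr do rewrite /X /M card_matching_image //.
  rewrite exchange_big /=; under eq_bigr => j _ do
    rewrite D1 /= ?(sp_eq _ _ _ p_bij) ?xpair_eqE ?andbF //.
  by rewrite sum_nat_const card_ord muln1.
(* Double count the arcs: an ordered pair of distinct vertices lies in exactly one [D i], a diagonal
   pair in none. *)
have kd : (k * d = (2 * k * n) * (2 * k * n).-1)%N.
  transitivity (\sum_(q : V * V) \sum_i (q \in D i))%N.
    rewrite exchange_big /= -[k in LHS]card_ord -sum_nat_const.
    by apply: eq_bigr => i _; rewrite sum_nat_of_bool cardsE Dd.
  transitivity (\sum_(q : V * V) (q.1 != q.2))%N.
    apply: eq_bigr => q _; have [q12|/D1 //] := eqVneq q.1 q.2.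
    by rewrite big1 // => i _; rewrite /D !inE q12 setUid cards1.
  rewrite -(pair_bigA _ (fun a b : V => nat_of_bool (a != b))) /=.
  rewrite -[in RHS](card_ord (2 * k * n)) -sum_nat_const; apply: eq_bigr => a _.
  rewrite sum_nat_of_bool -(cardsC1 a); apply: eq_card => b.
  by rewrite !inE eq_sym.
have [s sX] : exists s, (\sum_i X i s ^ 2 <= k * n ^ 2 + 3 * (k * n))%N.
  (* For k = 1 any permutation works: each X_i is at most kn, so the sum of squares is at most
     (kn)^2 = kn^2. *)
  have [k1|k_gt1] := leqP k 1.
    exists 1%g; apply: leq_trans (_ : (\sum_i X i 1%g) * (k * n) <= _)%N.
      rewrite big_distrl leq_sum //= => i _.
      by rewrite expnS expn1 leq_mul2l -(sumX 1%g) (bigD1 i) //= leq_addr orbT.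
    by rewrite sumX; nia.
  have := sum_sqr_count V (k * n) p p_bij k d D D1 Dd.
  under eq_bigr do under eq_bigr do rewrite -card_matching_image //.
  move/(exists_le_average _ 1%g) => [s Hs]; exists s.
  apply: second_moment_arith (kd) _ => //.
  by rewrite -[X in (X`! * _ <= _)%N](card_verts _ _ _ p_bij) -card_perm_type.
exists (M s); first exact: perfect_matching_image.
rewrite -/(X _ s).
have n_gt0 : 0 < n%:R :> R by rewrite ltr0n.
have k_ge1 : 1 <= k%:R :> R by rewrite ler1n.
set r := Num.sqrt (3 * n%:R : R).
have r_gt0 : 0 < r by rewrite sqrtr_gt0 mulr_gt0.
have rr : r ^+ 2 = 3 * n%:R by rewrite sqr_sqrtr // mulr_ge0 // ltW.
(* Since the X_i sum to kn, the sum of squared deviations is the sum of the X_i^2 minus kn^2. *)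
have sqX : \sum_(i < k) ((X i s)%:R - n%:R) ^+ 2 <= k%:R * r ^+ 2 :> R.
  have -> : \sum_(i < k) ((X i s)%:R - n%:R) ^+ 2 =
      (\sum_i X i s ^ 2)%N%:R - 2 * n%:R * (\sum_i X i s)%N%:R + k%:R * n%:R ^+ 2 :> R.
    have -> : k%:R * n%:R ^+ 2 = \sum_(i < k) n%:R ^+ 2 :> R.
      by rewrite sumr_const card_ord mulr_natl.
    rewrite !natr_sum mulr_sumr -sumrB -big_split /=; apply: eq_bigr => i _.
    by rewrite natrX; ring.
  rewrite sumX rr; move: sX; rewrite -(ler_nat R) natrD !natrM; lra.
(* AM-GM stands in for Cauchy-Schwarz: [r] is the bound on the quadratic mean *)
have amgm (x : R) : `|x| <= (x ^+ 2 / r + r) / 2.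
  have : 0 <= (`|x| - r) ^+ 2 / r by rewrite divr_ge0 ?sqr_ge0 // ltW.
  have -> : (`|x| - r) ^+ 2 / r = x ^+ 2 / r + r - 2 * `|x|.
    rewrite -(real_normK (num_real x)); field; exact: lt0r_neq0.
  lra.
apply: le_trans (_ : k%:R * r <= _).
  apply: le_trans (ler_sum _ (fun i _ => amgm _)) _.
  rewrite -mulr_suml big_split /= -mulr_suml sumr_const card_ord -[_ *+ k]mulr_natl.
  have : (\sum_(i < k) ((X i s)%:R - n%:R) ^+ 2) / r <= k%:R * r.
    by rewrite ler_pdivrMr // -mulrA -expr2.
  lra.
rewrite mulrAC [leRHS]mulrC ler_wpM2l //.
(* From ln(1 + x) <= x at x = -1/2, one gets ln 2 >= 1/2. *)
have ln_ge : 1 / 2 <= ln (2 * k%:R) :> R.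
  have := @le_ln1Dx R (- (1 / 2)); have -> : 1 + - (1 / 2) = 2^-1 :> R by lra.
  rewrite lnV ?posrE // lnM ?posrE //; last by lra.
  have := ln_ge0 k_ge1; lra.
(* After squaring, the claim is 3n <= 9kn ln(2k), and k ln(2k) >= 1/2 suffices. *)
rewrite -(@ler_pXn2r _ 2) ?nnegrE ?mulr_ge0 ?sqrtr_ge0 ?(ltW r_gt0) //.
rewrite rr exprMn sqr_sqrtr; last by rewrite !mulr_ge0 //; lra.
have kL : 1 / 2 <= k%:R * ln (2 * k%:R) :> R by nra.
nra.
Qed.
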